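(* Let $\mathcal{G}=(\mathcal{N},\mathcal{E})$ be a connected undirected graph, $\mathcal{N}=\{1,\dots,N\}$, with node degrees $d_i\ge 1$, let $f_i:\mathbf{R}^{n_i}\to\mathbf{R}\cup\{+\infty\}$ be convex, closed, and proper, $A_i\in\mathbf{R}^{m\times n_i}$, $b_i\in\mathbf{R}^m$ for all $i\in\mathcal{N}$, and let $\mathcal{K}\subseteq\mathbf{R}^m$ be a nonempty, closed, and convex cone. Consider the primal problem $$(\mathcal{P})\qquad \text{minimize over } x=(x_i)_{i\in\mathcal{N}}\quad \sum_{i\in\mathcal{N}} f_i(x_i)\quad\text{subject to}\quad \sum_{i\in\mathcal{N}}(A_ix_i-b_i)\in\mathcal{K},$$ and its dual $$(\mathcal{D})\qquad \text{maximize over } y\in\mathbf{R}^m\quad -\sum_{i\in\mathcal{N}}\big(f_i^*(-A_i^*y)+\langle y,b_i\rangle+\mathcal{I}_{\mathcal{K}^\circ}(y)\big).$$ Assume that a primal-dual solution exists and the duality gap is zero (i.e. $(\mathcal{P})$ has a minimizer, $(\mathcal{D})$ has a maximizer, and their optimal values are equal). Let $\rho>0$, let $y_i^0\in\mathbf{R}^m$ be arbitrary and $p_i^0=0$ for all $i\in\mathcal{N}$, and let the sequences $p_i^k,r_i^k,x_i^k,t_i^k,y_i^k$ be generated, for $k=0,1,2,\dots$ and all $i\in\mathcal{N}$, by $$\begin{aligned} p_i^{k+1}&=p_i^k+\rho\sum_{j\in\mathcal{N}_i}(y_i^k-y_j^k),\\ r_i^{k+1}&=\rho\sum_{j\in\mathcal{N}_i}(y_i^k+y_j^k)-(b_i+p_i^{k+1}),\\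 (x_i^{k+1},t_i^{k+1})&\in\operatorname*{argmin}_{(x_i,t_i)}\Big\{f_i(x_i)+\mathcal{I}_{\mathcal{K}}(t_i)+\tfrac{1}{4\rho d_i}\|A_ix_i+r_i^{k+1}-t_i\|^2\Big\},\\ y_i^{k+1}&=\tfrac{1}{2\rho d_i}\Pi_{\mathcal{K}^\circ}\big(A_ix_i^{k+1}+r_i^{k+1}\big). \end{aligned}$$ Then there is a maximizer $y^\star$ of $(\mathcal{D})$ such that for all $i\in\mathcal{N}$ the sequence $\{y_i^k\}_{k\in\mathbf{N}}$ converges to $y^\star$. Moreover, any limit point of the sequence $\{(x_i^k)_{i\in\mathcal{N}}\}_{k\in\mathbf{N}}$ is a minimizer of $(\mathcal{P})$.
   Context: Each $\mathbf{R}^n$ carries an inner product $\langle\cdot,\cdot\rangle$ with induced norm $\|\cdot\|$; $A^*$ is the adjoint of a linear operator $A$. $(x_i)_{i\in\mathcal{N}}$ is the vertical concatenation of the vectors $x_i$. The graph being undirected means $(i,j)\in\mathcal{E}$ implies $(j,i)\in\mathcal{E}$; $\mathcal{N}_i=\{j\in\mathcal{N}\mid (i,j)\in\mathcal{E}\}$ and $d_i=|\mathcal{N}_i|$. $f^*(y)=\sup_x\{\langle y,x\rangle-f(x)\}$ is the conjugate of $f$; $\mathcal{I}_{\mathcal{C}}$ is the indicator function of a set $\mathcal{C}$ (value $0$ on $\mathcal{C}$, $+\infty$ elsewhere); $\Pi_{\mathcal{C}}$ is the projection onto the nonempty closed convex set $\mathcal{C}$; $\mathcal{K}^\circ=\{y\mid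 \sup_{x\in\mathcal{K}}\langle x,y\rangle\le 0\}$ is the polar cone of $\mathcal{K}$. In the $(x_i,t_i)$-update, which need not have a unique minimizer, an arbitrary minimizer may be chosen. *)

(* Defs.v *)
From HB Require Import structures.
From mathcomp Require Import all_boot all_order all_algebra.
From mathcomp Require Import sesquilinear.
From mathcomp Require Import all_classical all_reals all_analysis.

Set Implicit Arguments.
Unset Strict Implicit.
Unset Printing Implicit Defensive.

Import Order.TTheory GRing.Theory Num.Theory.
Import numFieldNormedType.Exports.

Local Open Scope classical_set_scope.
Local Open Scope ring_scope.

(* R^n is ['cV[R]_n], whose library topology is the Euclidean one; the inner
   product carried by each R^n is arbitrary, [ip n] being the one on R^n. *)
Section InnerProduct.
Context {R : realType}.
Variable ip : forall n : nat, {dot 'cV[R]_n for idfun}.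

Definition ipnorm n (x : 'cV[R]_n) : R := Num.sqrt (ip n x x).

(* The unique such matrix; it exists by [adjointP] below. *)
Definition adjoint m n (A : 'M[R]_(m, n)) : 'M[R]_(n, m) :=
  xget 0 [set B : 'M[R]_(n, m) |
    forall (x : 'cV[R]_n) (y : 'cV[R]_m), ip m (A *m x) y = ip n x (B *m y)].

(* A minimal-distance point of C; it exists and is unique when C is nonempty,
   closed and convex, so the default value 0 is then irrelevant. *)
Definition projection m (C : set 'cV[R]_m) (z : 'cV[R]_m) : 'cV[R]_m :=
  xget 0 [set u | C u /\ forall c, C c -> ipnorm (z - u) <= ipnorm (z - c)].

Definition polar_cone m (K : set 'cV[R]_m) : set 'cV[R]_m :=
  [set y | (ereal_sup [set (ip m x y)%:E | x in K] <= 0)%E].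

Definition conjugate n (f : 'cV[R]_n -> \bar R) (y : 'cV[R]_n) : \bar R :=
  ereal_sup [set ((ip n y x)%:E - f x)%E | x in [set: 'cV[R]_n]].

Definition gram n : 'M[R]_n := \matrix_(i, j) ip n (delta_mx i 0) (delta_mx j 0).

Lemma ip_gram n (x y : 'cV[R]_n) : ip n x y = (x^T *m (gram n *m y)) 0 0.
Proof.
have cVE (z : 'cV[R]_n) : z = \sum_i z i 0 *: delta_mx i 0.
  by rewrite {1}[z]matrix_sum_delta; apply: eq_bigr => i _; rewrite big_ord1.
rewrite mxE {1}[x]cVE (linear_sumlz (ip n)); apply: eq_bigr => i _ /=.
rewrite linearZl_LR /= !mxE; congr (_ * _).
rewrite {1}[y]cVE (linear_sumr (ip n)); apply: eq_bigr => j _ /=.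
by rewrite linearZr_LR /= mxE mulrC.
Qed.

Lemma gram_unit n : gram n \in unitmx.
Proof.
rewrite -unitmx_tr -row_free_unit -kermx_eq0; apply/eqP/row_matrixP => i.
set u := row i _; rewrite row0.
have uG : u *m (gram n)^T = 0 by rewrite -row_mul mulmx_ker row0.
have Gu : gram n *m u^T = 0 by rewrite -[gram n]trmxK -trmx_mul uG trmx0.
apply: trmx_inj; rewrite trmx0; apply/eqP/negPn/negP => /(neq0_dnorm_gt0 (s := ip n)).
by rewrite ip_gram Gu mulmx0 mxE ltxx.
Qed.

Lemma adjointP m n (A : 'M[R]_(m, n)) (x : 'cV[R]_n) (y : 'cV[R]_m) :
  ip m (A *m x) y = ip n x (adjoint A *m y).
Proof.
move: x y; rewrite /adjoint.
set P := [set B | _].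
apply: (@xgetPex _ 0 P); exists (invmx (gram n) *m A^T *m gram m) => x y.
rewrite !ip_gram trmx_mul !mulmxA mulmxK.
  by [].
exact: gram_unit.
Qed.

End InnerProduct.

Section ConvexAnalysis.
Context {R : realType}.

(* Value 0 on C and +oo elsewhere, unlike the 0/1-valued library [\1_C]. *)
Definition indicator T (C : set T) (x : T) : \bar R :=
  if x \in C then 0%E else +oo%E.

Definition proper_fun n (f : 'cV[R]_n -> \bar R) :=
  (forall x, f x != -oo%E) /\ exists x, f x != +oo%E.

(* The library's [convex_function] only covers finite-valued functions. *)
Definition convex_fun n (f : 'cV[R]_n -> \bar R) :=
  forall (x y : 'cV[R]_n) (a : R), 0 <= a <= 1 ->
    (f (a *: x + (1 - a) *: y)%R <= a%:E * f x + (1 - a)%:E * f y)%E.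

Definition epigraph n (f : 'cV[R]_n -> \bar R) : set ('cV[R]_n * R) :=
  [set z | (f z.1 <= z.2%:E)%E].

Definition closed_fun n (f : 'cV[R]_n -> \bar R) := closed (epigraph f).

Definition is_cone m (K : set 'cV[R]_m) :=
  forall (a : R) (x : 'cV[R]_m), 0 <= a -> K x -> K (a *: x).

Definition argmin_on T (S : set T) (F : T -> \bar R) : set T :=
  [set x | S x /\ forall z, S z -> (F x <= F z)%E].

Definition argmax_on T (S : set T) (F : T -> \bar R) : set T :=
  [set x | S x /\ forall z, S z -> (F z <= F x)%E].

End ConvexAnalysis.

Section Graph.
Context {N : nat}.
Variable E : rel 'I_N.

Definition neighbors (i : 'I_N) : {set 'I_N} := [set j | E i j]%SET.

Definition degree (i : 'I_N) : nat := #|neighbors i|.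

Definition connected_graph := forall i j : 'I_N, connect E i j.

End Graph.

Section PrimalDual.
Context {R : realType} {N m : nat} {n : 'I_N -> nat}.
Variable ip : forall n : nat, {dot 'cV[R]_n for idfun}.
Variables (f : forall i, 'cV[R]_(n i) -> \bar R).
Variables (A : forall i, 'M[R]_(m, n i)) (b : 'I_N -> 'cV[R]_m).
Variable K : set 'cV[R]_m.

(* The primal variable is the vertical concatenation of its blocks x_i, which
   are recovered as [submxcol x i]. *)
Definition primal_objective (x : 'cV[R]_(\sum_i n i)) : \bar R :=
  (\sum_i f (submxcol x i))%E.

Definition primal_feasible : set 'cV[R]_(\sum_i n i) :=
  [set x | K (\sum_i (A i *m submxcol x i - b i))].

Definition primal_minimizers : set 'cV[R]_(\sum_i n i) :=
  argmin_on primal_feasible primal_objective.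

Definition primal_value : \bar R :=
  ereal_inf [set primal_objective x | x in primal_feasible].

Definition dual_objective (y : 'cV[R]_m) : \bar R :=
  (- \sum_i (conjugate ip (@f i) (- (adjoint ip (A i) *m y))%R
             + (ip m y (b i))%:E + indicator (polar_cone ip K) y))%E.

Definition dual_maximizers : set 'cV[R]_m :=
  argmax_on [set: 'cV[R]_m] dual_objective.

Definition dual_value : \bar R :=
  ereal_sup [set dual_objective y | y in [set: 'cV[R]_m]].

End PrimalDual.

(* Main.v *)
(* Put v_i = b_i + t_i - A_i x_i. The updates say that v_i is a subgradient at
   y_i of the i-th dual function, and, with w the running sum of the y's,
   p = rho L w and
     v^(k+1) = - rho (L w^(k+2) + Q (y^(k+1) - y^k)),
   where L and Q are the Laplacian and the signless Laplacian of the graph.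
   Polarizing the two quadratic forms turns the monotonicity of the
   subdifferential, tested against a primal-dual solution, into the decrease of
     V_k = |w^(k+1) - w*|_L^2 + |y^k - y*|_Q^2,
   which gives consensus, boundedness and vanishing monotonicity gaps. Limits
   along an ultrafilter provide a reference point for which V_k tends to 0, so y
   and v converge. The vanishing gaps show that the limit of y satisfies the KKT
   conditions together with the primal solution, hence is dual optimal; the same
   inequalities bound the values f_i(x_i^k) along a limit point of x, and the
   closedness of the epigraphs yields its primal optimality. *)
Require Import Defs.
From HB Require Import structures.
From mathcomp Require Import all_boot all_order all_algebra.
From mathcomp Require Import sesquilinear.
From mathcomp Require Import all_classical all_reals all_analysis.
From mathcomp Require Import ring lra.

Set Implicit Arguments.
Unset Strict Implicit.
Unset Printing Implicit Defensive.

Import Order.TTheory GRing.Theory Num.Theory.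
Import numFieldNormedType.Exports.

Local Open Scope classical_set_scope.
Local Open Scope ring_scope.

(** * Inner products and coordinates *)

Section InnerProductTheory.
Context {R : realType}.
Variable ip : forall n : nat, {dot 'cV[R]_n for idfun}.
Context {m : nat}.
Implicit Types u v w : 'cV[R]_m.
Local Notation "''[' u , v ]" := (ip m u%R v%R) : ring_scope.
Local Notation "''[' u ]" := (ip m u%R u%R) : ring_scope.

Lemma ipC u v : '[u, v] = '[v, u].
Proof. by rewrite [LHS]hermC /= expr0 mul1r. Qed.

Lemma ipDl u v w : '[u + v, w] = '[u, w] + '[v, w].
Proof. by rewrite linearDl. Qed.
Lemma ipDr u v w : '[u, v + w] = '[u, v] + '[u, w].
Proof. by rewrite linearDr. Qed.
Lemma ipZl a u v : '[a *: u, v] = a * '[u, v].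
Proof. by rewrite linearZl_LR. Qed.
Lemma ipZr a u v : '[u, a *: v] = a * '[u, v].
Proof. by rewrite linearZr_LR. Qed.
Lemma ipNl u v : '[- u, v] = - '[u, v].
Proof. by rewrite linearNl. Qed.
Lemma ipNr u v : '[u, - v] = - '[u, v].
Proof. by rewrite linearNr. Qed.
Lemma ip0l u : '[0, u] = 0.
Proof. by rewrite linear0l. Qed.
Lemma ip0r u : '[u, 0] = 0.
Proof. by rewrite linear0r. Qed.
Lemma ip_suml I (s : seq I) (P : pred I) (F : I -> 'cV[R]_m) u :
  '[\sum_(i <- s | P i) F i, u] = \sum_(i <- s | P i) '[F i, u].
Proof. by rewrite linear_sumlz. Qed.
Lemma ip_sumr I (s : seq I) (P : pred I) (F : I -> 'cV[R]_m) u :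
  '[u, \sum_(i <- s | P i) F i] = \sum_(i <- s | P i) '[u, F i].
Proof. by rewrite linear_sumr. Qed.

Definition ipE := (ipDl, ipDr, ipNl, ipNr, ipZl, ipZr).

Lemma ip_ge0 u : 0 <= '[u].
Proof.
have [->|u0] := eqVneq u 0; first by rewrite ip0l.
exact/ltW/neq0_dnorm_gt0.
Qed.

Lemma ip_le0_eq0 u : '[u] <= 0 -> u = 0.
Proof. by apply: contraTeq => /(neq0_dnorm_gt0 (s := ip m)); rewrite -ltNge. Qed.

Lemma ipnorm_sq u : ipnorm ip u ^+ 2 = '[u].
Proof. by rewrite /ipnorm sqr_sqrtr // ip_ge0. Qed.

Lemma ip_sqD_le u v : '[u + v] <= 2 * '[u] + 2 * '[v].
Proof. by have := ip_ge0 (u - v); rewrite !ipE (ipC v u); lra. Qed.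

Lemma ip_Cauchy_Schwarz u v : '[u, v] ^+ 2 <= '[u] * '[v].
Proof.
have [->|v0] := eqVneq v 0; first by rewrite !ip0r expr2 mul0r mulr0.
have vv : 0 < '[v] by exact: neq0_dnorm_gt0.
have := ip_ge0 ('[v] *: u - '[u, v] *: v); rewrite !ipE (ipC v u) => h.
have {h} : 0 <= '[v] * ('[u] * '[v] - '[u, v] ^+ 2) by move: h; congr (_ <= _); ring.
by rewrite pmulr_rge0 // subr_ge0.
Qed.

(* Coordinates are inner products with the columns of the inverse Gram matrix. *)
Lemma coord_ip u i : u i 0 = '[u, invmx (gram ip m) *m delta_mx i 0].
Proof.
by rewrite ip_gram mulKVmx ?gram_unit // -colE mxE mxE.
Qed.

(** Cauchy-Schwarz applied to [coord_ip]. This ties the arbitrary inner product to the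
    coordinatewise topology. The summand 1 in the constant keeps it positive when [m] is 0. *)
Lemma coord_sq_le : exists2 C, 0 < C & forall u i, (u i 0) ^+ 2 <= C * '[u].
Proof.
pose d i := '[invmx (gram ip m) *m delta_mx i 0].
exists (1 + \sum_i d i) => [|u i].
  by rewrite ltr_pwDl // sumr_ge0 // => i _; exact: ip_ge0.
rewrite coord_ip (le_trans (ip_Cauchy_Schwarz _ _)) // mulrC ler_wpM2r ?ip_ge0 //.
rewrite (bigD1 i) //= addrCA lerDl addr_ge0 // sumr_ge0 // => j _; exact: ip_ge0.
Qed.

End InnerProductTheory.

(** * Limits of vectors along a filter *)

Section FilterLimits.
Context {R : realType}.
Variable ip : forall n : nat, {dot 'cV[R]_n for idfun}.
Context {I : Type} {F : set_system I} {FF : Filter F}.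

Lemma cvg_col {m} (u : I -> 'cV[R]_m) (l : 'cV[R]_m) :
  (forall i, (fun k => u k i 0) @ F --> l i 0) -> u @ F --> l.
Proof.
move=> h; apply/cvg_ballP => e e0.
have : \forall k \near F, forall i, ball (l i 0) e (u k i 0).
  by apply: filter_forall => i; move/cvg_ballP : (h i); exact.
apply: filterS => k uk; split=> // i j; rewrite (ord1 j); exact: uk.
Qed.

Lemma cvg_coord {m} (u : I -> 'cV[R]_m) (l : 'cV[R]_m) i :
  u @ F --> l -> (fun k => u k i 0) @ F --> l i 0.
Proof.
move=> ul; have c : {for l, continuous (fun M : 'cV[R]_m => M i 0)}.
  exact: coord_continuous.
exact: continuous_cvg c ul.
Qed.

Lemma cvg_finsum {V : normedModType R} {J : Type} (s : seq J) (P : pred J)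
    (u : J -> I -> V) (l : J -> V) :
  (forall j, P j -> u j @ F --> l j) ->
  (fun k => \sum_(j <- s | P j) u j k) @ F --> \sum_(j <- s | P j) l j.
Proof. by move=> ul; apply: cvg_big => //; exact: add_continuous. Qed.

Lemma cvg_mulmx {m n} (B : 'M[R]_(m, n)) (u : I -> 'cV[R]_n) (l : 'cV[R]_n) :
  u @ F --> l -> (fun k => B *m u k) @ F --> B *m l.
Proof.
move=> ul; apply: cvg_col => i; rewrite mxE.
under eq_cvg do rewrite mxE.
apply: cvg_finsum => j _; apply: cvgMr; exact: cvg_coord.
Qed.

Lemma cvg_ip {m} (u v : I -> 'cV[R]_m) (l l' : 'cV[R]_m) :
  u @ F --> l -> v @ F --> l' ->
  (fun k => ip m (u k) (v k)) @ F --> ip m l l'.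
Proof.
move=> ul vl; rewrite ip_gram mxE.
under eq_cvg do rewrite ip_gram mxE.
apply: cvg_finsum => j _; rewrite mxE.
under eq_cvg do rewrite mxE.
by apply: cvgM; apply: cvg_coord => //; exact: cvg_mulmx.
Qed.

Lemma cvg_ip_sq0 {m} (u : I -> 'cV[R]_m) (l : 'cV[R]_m) :
  (fun k => ip m (u k - l) (u k - l)) @ F --> 0 -> u @ F --> l.
Proof.
move=> h; apply: cvg_col => i; have [C C0 hC] := coord_sq_le ip (m := m).
apply/cvgrPdist_lt => e e0.
have : \forall k \near F, ip m (u k - l) (u k - l) < e ^+ 2 / C.
  by apply: cvgr_lt h _ _; rewrite divr_gt0 // exprn_gt0.
apply: filterS => k; rewrite ltr_pdivlMr // mulrC => /(le_lt_trans (hC _ i)).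
rewrite !mxE -real_normK ?num_real // distrC => h1.
by rewrite -(@ltr_pXn2r _ 2) // nnegrE ltW.
Qed.

End FilterLimits.

(** * Compactness along ultrafilters *)

Section UltraLimits.
Context {R : realType}.
Variable ip : forall n : nat, {dot 'cV[R]_n for idfun}.
Context {I : Type} {U : set_system I} {UU : UltraFilter U}.

(** Compactness of the segment gives a cluster point, and an ultrafilter converges to each of its
    cluster points. *)
Lemma ultra_bounded_cvgr (u : I -> R) a b :
  (\forall k \near U, a <= u k <= b) -> exists l : R, u @ U --> l.
Proof.
move=> uab; have [|l [_ ul]] := @segment_compact R a b (u @ U) _.
  by apply: filterS uab => k; rewrite /= in_itv.
exists l => B /= lB; have [//|UB] := in_ultra_setVsetC (u @^-1` B) UU.
by have [z [zB /zB]] := ul (~` B) B UB lB.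
Qed.

Lemma ultra_bounded_cvg {m : nat} (u : I -> 'cV[R]_m) (C : R) :
  (\forall k \near U, ip m (u k) (u k) <= C) -> exists l : 'cV[R]_m, u @ U --> l.
Proof.
move=> uC; have [D D0 hD] := coord_sq_le ip (m := m).
have h i : exists l : R, (fun k => u k i 0) @ U --> l.
  apply: (@ultra_bounded_cvgr _ (- (1 + D * C)) (1 + D * C)).
  apply: filterS uC => k uk.
  have := le_trans (hD (u k) i) (ler_wpM2l (ltW D0) uk) => hk.
  by apply/andP; split; nra.
have [l hl] := choice h.
by exists (\col_i l i); apply: cvg_col => i; rewrite mxE.
Qed.

End UltraLimits.

(** * Quadratic forms of the graph *)

Section GraphEnergy.
Context {R : realType} {N m : nat}.
Variable ip : forall n : nat, {dot 'cV[R]_n for idfun}.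
Variable E : rel 'I_N.
Hypothesis symE : symmetric E.
Implicit Types (u z p q : 'I_N -> 'cV[R]_m) (s : R).

(* The graph Laplacian for s = -1 and the signless Laplacian for s = 1. *)
Definition laplacian s u (i : 'I_N) : 'cV[R]_m :=
  \sum_(j in neighbors E i) (u i + s *: u j).

(** For [s = -1] and [z = u] this is twice the Dirichlet energy: with [E] symmetric, both
    orientations of an edge are summed. *)
Definition edge_form s u z : R :=
  \sum_i \sum_(j in neighbors E i) ip m (u i + s *: u j) (z i + s *: z j).

Lemma sum_neighbors_swap {V : nmodType} (F : 'I_N -> 'I_N -> V) :
  \sum_i \sum_(j in neighbors E i) F i j = \sum_i \sum_(j in neighbors E i) F j i.
Proof.
rewrite (exchange_big_dep predT) //=; apply: eq_bigr => i _.
by apply: eq_bigl => j; rewrite !inE symE.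
Qed.

(** Reversing every edge and using [s * s = 1] turns the contribution of [s *: z j] into that of
    [z i]; the two equal halves give the factor 2. *)
Lemma edge_form_laplacian s u z : s * s = 1 ->
  edge_form s u z = 2 * \sum_i ip m (laplacian s u i) (z i).
Proof.
move=> ss; rewrite mulr_natl mulr2n {2}/laplacian.
have -> : \sum_i ip m (laplacian s u i) (z i) =
    \sum_i \sum_(j in neighbors E i) ip m (u i + s *: u j) (z i).
  by apply: eq_bigr => i _; rewrite ip_suml.
have {2}-> : \sum_i \sum_(j in neighbors E i) ip m (u i + s *: u j) (z i) =
    \sum_i \sum_(j in neighbors E i) ip m (u i + s *: u j) (s *: z j).
  rewrite sum_neighbors_swap; apply: eq_bigr => i _; apply: eq_bigr => j _.
  by rewrite !ipE (mulrA s s) ss mul1r addrC.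
rewrite -big_split; apply: eq_bigr => i _; rewrite -big_split.
by apply: eq_bigr => j _; rewrite ipDr.
Qed.

Lemma edge_formC s u z : edge_form s u z = edge_form s z u.
Proof. by apply: eq_bigr => i _; apply: eq_bigr => j _; rewrite ipC. Qed.

Lemma edge_form_polar s p q :
  2 * edge_form s p (p - q) =
  edge_form s p p - edge_form s q q + edge_form s (p - q) (p - q).
Proof.
rewrite /edge_form mulr_sumr -sumrB -big_split; apply: eq_bigr => i _.
rewrite mulr_sumr -sumrB -big_split; apply: eq_bigr => j _ /=.
rewrite !fctE !ipE (ipC ip (q i) (p i)) (ipC ip (q j) (p i)) (ipC ip (q i) (p j))
  (ipC ip (q j) (p j)) (ipC ip (q j) (q i)) (ipC ip (p j) (p i)).
ring.
Qed.

Lemma edge_form_ge0 s u : 0 <= edge_form s u u.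
Proof. by apply: sumr_ge0 => i _; apply: sumr_ge0 => j _; exact: ip_ge0. Qed.

Lemma edge_term_le s u i j : E i j ->
  ip m (u i + s *: u j) (u i + s *: u j) <= edge_form s u u.
Proof.
move=> Eij; rewrite /edge_form (bigD1 i) //= (bigD1 j) ?inE //= -addrA lerDl.
apply: addr_ge0; first by apply: sumr_ge0 => k _; exact: ip_ge0.
by apply: sumr_ge0 => k _; apply: sumr_ge0 => l _; exact: ip_ge0.
Qed.

Lemma sum_laplacianN1 u : \sum_i laplacian (-1) u i = 0.
Proof.
apply: (@ip_le0_eq0 _ ip); rewrite ip_suml.
(* The test field is constant, equal to the sum itself. Its edge differences vanish, so the sum is
   orthogonal to itself. *)
have := @edge_form_laplacian (-1) u (fun=> \sum_i laplacian (-1) u i) _.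
rewrite mulrNN mulr1 /edge_form => /(_ erefl) e.
have : 2 * \sum_i ip m (laplacian (-1) u i) (\sum_i laplacian (-1) u i) = 0.
  rewrite -e big1 // => i _; rewrite big1 // => j _.
  by rewrite !scaleN1r subrr ip0r.
lra.
Qed.

(** Trades the degree scaling of the y-update for the two Laplacians. *)
Lemma laplacian_add_signless u i :
  laplacian (-1) u i + laplacian 1 u i = (2 * (degree E i)%:R) *: u i.
Proof.
rewrite /laplacian -big_split mulrC -scalerA scaler_nat -sumr_const.
by apply: eq_bigr => j _ /=; apply/colP => a; rewrite !mxE; ring.
Qed.

(** Induction along a path with [ip_sqD_le]. The constant depends on the path only, so one bound
    serves all iterates. *)
Lemma connect_dist_le i j : connect E i j -> exists2 c : R, 0 <= c &
  forall u (B : R), 0 <= B ->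
    (forall k l, E k l -> ip m (u k - u l) (u k - u l) <= B) ->
    ip m (u i - u j) (u i - u j) <= c * B.
Proof.
case/connectP => p + ->; elim: p i => [|k p IH] i /=.
  by move=> _; exists 0 => // u B _ _; rewrite subrr ip0l mul0r.
case/andP => Eik /IH [c c0 hc]; exists (2 + 2 * c); first by lra.
move=> u B B0 hB; have := hc u B B0 hB; have := hB _ _ Eik.
move=> h1 h2; rewrite -(subrKA (u k)); have := ip_sqD_le ip (u i - u k) (u k - u (last k p)).
lra.
Qed.

End GraphEnergy.

(** * Range of the graph Laplacian *)

Section LaplacianRange.
Context {R : realType} {N m : nat}.
Variable E : rel 'I_N.
Hypotheses (symE : symmetric E) (connE : connected_graph E).
Variable ip : forall n : nat, {dot 'cV[R]_n for idfun}.

Let L : 'M[R]_N := \matrix_(i, j) ((degree E i)%:R *+ (i == j) - (E i j)%:R).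

Let LE (c : 'I_N -> R) i : \sum_j L i j * c j = \sum_(j in neighbors E i) (c i - c j).
Proof.
rewrite sumrB sumr_const -[X in _ *+ X]/(degree E i) /L.
under eq_bigr do rewrite mxE mulrBl.
rewrite sumrB; congr (_ - _).
  rewrite (bigD1 i) //= eqxx mulr1n big1 ?addr0 ?mulr_natl // => j ji.
  by rewrite eq_sym (negbTE ji) mulr0n mul0r.
rewrite [RHS]big_mkcond; apply: eq_bigr => j _ /=.
by rewrite inE; case: (E i j); rewrite ?mul1r ?mul0r.
Qed.

(** A harmonic function has zero energy, hence equal values across each edge, and connectedness
    spreads the equality. Scalars are encoded as vectors of length 1 to reuse the energy. *)
Lemma laplacian_harmonic_const (c : 'I_N -> R) :
  (forall i, \sum_(j in neighbors E i) (c i - c j) = 0) -> forall i j, c i = c j.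
Proof.
move=> hc i j; pose u k : 'cV[R]_1 := const_mx (c k).
have lap0 k : laplacian E (-1) u k = 0.
  apply/matrixP => a b; rewrite summxE mxE -[RHS](hc k).
  by apply: eq_bigr => l _; rewrite !mxE mulN1r.
have S0 : edge_form ip E (-1) u u = 0.
  rewrite edge_form_laplacian // ?mulrNN ?mulr1 // big1 ?mulr0 // => k _.
  by rewrite lap0 ip0l.
have [d _ hd] := @connect_dist_le _ _ 1 ip E _ _ (connE i j).
have : ip 1 (u i - u j) (u i - u j) <= d * 0.
  apply: hd => // k l Ekl; rewrite -S0 -(scaleN1r (u l)); exact: edge_term_le.
rewrite mulr0 => /ip_le0_eq0/matrixP/(_ 0 0); rewrite !mxE => /eqP.
by rewrite subr_eq0 => /eqP.
Qed.

(* The cokernel of the Laplacian consists of constants, on which a vector of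
   zero sum vanishes. *)
Lemma laplacian_range (v : 'I_N -> 'cV[R]_m) : \sum_i v i = 0 ->
  exists w : 'I_N -> 'cV[R]_m, forall i, laplacian E (-1) w i = v i.
Proof.
move=> v0; pose V : 'M[R]_(m, N) := \matrix_(a, i) v i a 0.
have : (V <= L)%MS.
  rewrite submxE; apply/eqP/matrixP => a b; rewrite !mxE.
  have C i j : cokermx L i b = cokermx L j b.
    apply: laplacian_harmonic_const (fun i => cokermx L i b) _ i j => {}i.
    by rewrite -LE; have /matrixP/(_ i b) := mulmx_coker L; rewrite !mxE.
  case: (pickP (@predT 'I_N)) => [i0 _|N0]; last by rewrite big_pred0.
  under eq_bigr => i _ do rewrite (C i i0) mxE.
  by rewrite -mulr_suml; move/matrixP/(_ a 0): v0; rewrite summxE mxE => ->; rewrite mul0r.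
case/submxP => W VW; exists (fun i => col i W) => i.
apply/colP => a; have /matrixP/(_ a i) := VW; rewrite !mxE summxE => ->.
(* Symmetry of [L] turns the right action on the rows of [W] into the Laplacian of its columns. *)
under [RHS]eq_bigr => j _.
  rewrite (_ : L j i = L i j) 1?mulrC; first over.
  by rewrite !mxE symE eq_sym; case: eqP => [->|].
by rewrite LE; apply: eq_bigr => j _; rewrite !mxE mulN1r.
Qed.

End LaplacianRange.

(** * Limits of the quadratic forms *)

Section GraphLimits.
Context {R : realType} {N m : nat}.
Variable ip : forall n : nat, {dot 'cV[R]_n for idfun}.
Variable E : rel 'I_N.
Context {I : Type} {F : set_system I} {FF : Filter F}.
Implicit Types (u : I -> 'I_N -> 'cV[R]_m) (s : R).

Lemma edge_form_cvg s u l : (forall i, (fun k => u k i) @ F --> l i) ->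
  (fun k => edge_form ip E s (u k) (u k)) @ F --> edge_form ip E s l l.
Proof.
move=> ul; apply: cvg_finsum => i _; apply: cvg_finsum => j _.
apply: cvg_ip; (apply: cvgD; [|apply: cvgZr]); exact: ul.
Qed.

Lemma cvg0_le (f g : I -> R) : (forall k, 0 <= f k <= g k) ->
  g @ F --> 0 -> f @ F --> 0.
Proof.
move=> fg g0; apply: (squeeze_cvgr _ (cvg_cst 0) g0); exact: nearW.
Qed.

Lemma edge_cvg0 s u i j : E i j ->
  (fun k => edge_form ip E s (u k) (u k)) @ F --> 0 ->
  (fun k => u k i + s *: u k j) @ F --> (0 : 'cV[R]_m).
Proof.
move=> Eij u0; apply: (@cvg_ip_sq0 _ ip); apply: cvg0_le u0 => k.
by rewrite subr0 ip_ge0 edge_term_le.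
Qed.

Lemma laplacian_cvg0 s u i :
  (fun k => edge_form ip E s (u k) (u k)) @ F --> 0 ->
  (fun k => laplacian E s (u k) i) @ F --> (0 : 'cV[R]_m).
Proof.
move=> u0; have <- : \sum_(j in neighbors E i) (0 : 'cV[R]_m) = 0 by rewrite big1_eq.
by apply: cvg_finsum => j; rewrite inE => Eij; exact: edge_cvg0.
Qed.

End GraphLimits.

(** * Lyapunov analysis of the recursion *)

Section DecentralizedADMM.
Context {R : realType} {N m : nat}.
Variable ip : forall n : nat, {dot 'cV[R]_n for idfun}.
Variable E : rel 'I_N.
Hypotheses (symE : symmetric E) (connE : connected_graph E).
Hypothesis degE : forall i, (1 <= degree E i)%N.
Variables (i0 : 'I_N) (rho : R).
Hypothesis rho0 : 0 < rho.
Variables y v w : nat -> 'I_N -> 'cV[R]_m.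
Hypothesis w_rec : forall k i, w k.+1 i = w k i + y k i.
(* In the algorithm p = rho *: L w with L the Laplacian, and v k i is the
   subgradient of the i-th dual function at y k.+1 i. *)
Hypothesis v_eq : forall k i,
  v k i = - (rho *: (laplacian E (-1) (w k.+2) i
                     + laplacian E 1 (y k.+1 - y k) i)).
Implicit Types (ws : 'I_N -> 'cV[R]_m) (ys : 'cV[R]_m).

Local Notation S := (edge_form (m := m) ip E).

(** The value that [v_eq] gives once the Laplacian of [w] has reached that of [ws] and [y] has
    stopped moving. *)
Definition vstar ws (i : 'I_N) := - (rho *: laplacian E (-1) ws i).

(** The index of [w] is one ahead because [w k.+1] is the first partial sum containing [y k]; its
    next increment is then [y k.+1]. *)
Definition lyapunov ws ys k :=
  S (-1) (w k.+1 - ws) (w k.+1 - ws) + S 1 (y k - cst ys) (y k - cst ys).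

Definition monotonicity_gap ws ys k :=
  \sum_i ip m (v k i - vstar ws i) (y k.+1 i - ys).

Lemma laplacianB s (p q : 'I_N -> 'cV[R]_m) i :
  laplacian E s (p - q) i = laplacian E s p i - laplacian E s q i.
Proof.
rewrite /laplacian -sumrB; apply: eq_bigr => j _.
by rewrite !fctE scalerBr opprD addrACA.
Qed.

Lemma lyapunov_step ws ys k :
  4 / rho * monotonicity_gap ws ys k + S (-1) (y k.+1) (y k.+1)
    + S 1 (y k.+1 - y k) (y k.+1 - y k)
  = lyapunov ws ys k - lyapunov ws ys k.+1.
Proof.
pose z := y k.+1 - cst ys; pose d := y k.+1 - y k.
have gapE : monotonicity_gap ws ys k =
    - rho / 2 * (S (-1) (w k.+2 - ws) z + S 1 d z).
  rewrite !edge_form_laplacian ?mulrNN ?mulr1 // -mulrDr mulrA divfK //.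
  rewrite -big_split mulr_sumr; apply: eq_bigr => i _ /=.
  rewrite -ipDl -ipZl laplacianB v_eq /vstar -/d; congr (ip m _ _).
  by apply/colP => a; rewrite !mxE; ring.
(* The constant [ys] disappears from edge differences, so [z] may be replaced by the increment of
   [w], which makes the form polarizable. *)
have SwE : S (-1) (w k.+2 - ws) z = S (-1) (w k.+2 - ws) ((w k.+2 - ws) - (w k.+1 - ws)).
  apply: eq_bigr => i _; apply: eq_bigr => j _; congr (ip m _ _).
  rewrite /z !fctE !w_rec !scaleN1r.
  apply/colP => a; rewrite !mxE; ring.
have dE : d = z - (y k - cst ys).
  by apply/funext => i; rewrite /d /z !fctE; apply/colP => a; rewrite !mxE; ring.
have SyE : S (-1) (y k.+1) (y k.+1) =
    S (-1) ((w k.+2 - ws) - (w k.+1 - ws)) ((w k.+2 - ws) - (w k.+1 - ws)).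
  congr (S _ _ _); apply/funext => i;
  rewrite !fctE !w_rec; apply/colP => a; rewrite !mxE; ring.
have h1 := edge_form_polar ip E (-1) (w k.+2 - ws) (w k.+1 - ws).
have h2 := edge_form_polar ip E 1 z (y k - cst ys).
rewrite -/d SyE gapE SwE [S 1 d z]edge_formC dE /lyapunov -/z.
have -> (a b : R) : 4 / rho * (- rho / 2 * (a + b)) = - (2 * a) - 2 * b.
  by field; rewrite gt_eqF.
rewrite h1 h2; ring.
Qed.

Lemma lyapunov_ge0 ws ys k : 0 <= lyapunov ws ys k.
Proof. by rewrite addr_ge0 // edge_form_ge0. Qed.

Section Descent.
Variables (ws : 'I_N -> 'cV[R]_m) (ys : 'cV[R]_m).
Hypothesis gap_ge0 : forall k, 0 <= monotonicity_gap ws ys k.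

Let coef_gt0 : 0 < 4 / rho. Proof. by rewrite divr_gt0. Qed.

Lemma lyapunov_nonincreasing : nonincreasing_seq (lyapunov ws ys).
Proof.
apply/nonincreasing_seqP => k; rewrite -subr_ge0 -lyapunov_step.
by rewrite !addr_ge0 ?edge_form_ge0 // mulr_ge0 // ltW.
Qed.

Lemma lyapunov_cvg : lyapunov ws ys @ \oo --> inf (range (lyapunov ws ys)).
Proof.
apply: nonincreasing_cvgn; first exact: lyapunov_nonincreasing.
by exists 0 => _ [k _ <-]; exact: lyapunov_ge0.
Qed.

Lemma lyapunov_diff_cvg0 :
  (fun k => lyapunov ws ys k - lyapunov ws ys k.+1) @ \oo --> 0.
Proof.
rewrite -(subrr (inf (range (lyapunov ws ys)))).
apply: cvgB; first exact: lyapunov_cvg.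
by have := lyapunov_cvg; rewrite -[in X in X -> _]cvg_shiftS.
Qed.

Lemma gap_cvg0 : monotonicity_gap ws ys @ \oo --> 0.
Proof.
have -> : monotonicity_gap ws ys =
    (fun k => rho / 4 * (4 / rho * monotonicity_gap ws ys k)).
  by apply/funext => k; field; rewrite gt_eqF.
rewrite -(mulr0 (rho / 4)); apply: cvgMr.
apply: cvg0_le lyapunov_diff_cvg0 => k; rewrite -lyapunov_step -addrA lerDl.
by rewrite addr_ge0 ?edge_form_ge0 // mulr_ge0 // ltW.
Qed.

Lemma consensus_energy_cvg0 : (fun k => S (-1) (y k.+1) (y k.+1)) @ \oo --> 0.
Proof.
apply: cvg0_le lyapunov_diff_cvg0 => k; rewrite edge_form_ge0 -lyapunov_step.
by rewrite addrAC lerDr addr_ge0 ?edge_form_ge0 // mulr_ge0 // ltW.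
Qed.

Lemma increment_energy_cvg0 :
  (fun k => S 1 (y k.+1 - y k) (y k.+1 - y k)) @ \oo --> 0.
Proof.
apply: cvg0_le lyapunov_diff_cvg0 => k; rewrite edge_form_ge0 -lyapunov_step.
by rewrite lerDr addr_ge0 ?edge_form_ge0 // mulr_ge0 // ltW.
Qed.

(** Along an edge to a neighbor [j], twice [y i - ys] is the sum of the deviations at [i] and [j]
    plus the difference [y i - y j]. The signless form bounds the first and the Laplacian form the
    second; the signless form alone is degenerate on bipartite graphs. *)
Lemma dist_le_lyapunov k i :
  ip m (y k.+1 i - ys) (y k.+1 i - ys) <=
  lyapunov ws ys k.+1 + S (-1) (y k.+1) (y k.+1).
Proof.
have /card_gt0P[j] := degE i; rewrite inE => Eij.
have h1 : ip m (y k.+1 i - ys + (y k.+1 j - ys)) (y k.+1 i - ys + (y k.+1 j - ys))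
    <= S 1 (y k.+1 - cst ys) (y k.+1 - cst ys).
  by have := edge_term_le ip 1 (y k.+1 - cst ys) Eij; rewrite scale1r.
have h2 : ip m (y k.+1 i - y k.+1 j) (y k.+1 i - y k.+1 j) <= S (-1) (y k.+1) (y k.+1).
  by have := edge_term_le ip (-1) (y k.+1) Eij; rewrite scaleN1r.
have := ip_sqD_le ip (y k.+1 i - ys + (y k.+1 j - ys)) (y k.+1 i - y k.+1 j).
have -> : y k.+1 i - ys + (y k.+1 j - ys) + (y k.+1 i - y k.+1 j) =
    2 *: (y k.+1 i - ys) by apply/colP => a; rewrite !mxE; ring.
rewrite ipZl ipZr; move: h1 h2.
have : 0 <= S (-1) (w k.+2 - ws) (w k.+2 - ws) by exact: edge_form_ge0.
have : 0 <= S (-1) (y k.+1) (y k.+1) by exact: edge_form_ge0.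
have := ip_ge0 ip (y k.+1 i - ys).
by rewrite /lyapunov; lra.
Qed.

End Descent.

Lemma vstar_sum0 ws : \sum_i vstar ws i = 0.
Proof. by rewrite sumrN -scaler_sumr sum_laplacianN1 // scaler0 oppr0. Qed.

Lemma v_cvg {F : set_system nat} {FF : Filter F} ws i :
  (fun k => S (-1) (w k.+2 - ws) (w k.+2 - ws)) @ F --> 0 ->
  (fun k => S 1 (y k.+1 - y k) (y k.+1 - y k)) @ F --> 0 ->
  (fun k => v k i) @ F --> vstar ws i.
Proof.
move=> hw hy.
have -> : (fun k => v k i) = (fun k => - (rho *: (laplacian E (-1) ws i
    + laplacian E (-1) (w k.+2 - ws) i + laplacian E 1 (y k.+1 - y k) i))).
  by apply/funext => k; rewrite v_eq (laplacianB _ (w _) ws) [laplacian _ _ ws i + _]addrC subrK.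
rewrite /vstar -[X in - (rho *: X)]addr0 -[X in - (rho *: (X + _))]addr0.
apply: cvgN; apply: cvgZr; apply: cvgD; last exact: laplacian_cvg0 hy.
by apply: cvgD; [exact: cvg_cst|exact: laplacian_cvg0 hw].
Qed.

(* Two passes: an assumed solution makes the iterates bounded, and a cluster
   point (wbar, ybar), which inherits nonnegative gaps from the pairwise
   monotonicity of the iterates, is then a reference point whose Lyapunov
   function tends to 0 along the ultrafilter, hence along the sequence. *)
Lemma admm_convergence ws ys :
  (forall k, 0 <= monotonicity_gap ws ys k) ->
  (forall k l i, 0 <= ip m (v k i - v l i) (y k.+1 i - y l.+1 i)) ->
  exists (ybar : 'cV[R]_m) (vbar : 'I_N -> 'cV[R]_m), [/\ \sum_i vbar i = 0,
    forall i, (fun k => y k i) @ \oo --> ybar &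
    forall i, (fun k => v k i) @ \oo --> vbar i].
Proof.
move=> gap0 mono.
(* An ultrafilter finer than [\oo] replaces the extraction of subsequences. *)
have [U [UU hU]] := ultraFilterLemma eventually_filter.
have cvgU (T : topologicalType) (u : nat -> T) (l : T) : u @ \oo --> l -> u @ U --> l.
  by move=> ul B /ul; exact: hU.
have yS0 := consensus_energy_cvg0 gap0.
have dyS0 := increment_energy_cvg0 gap0.
pose C := lyapunov ws ys 0.
have lyC k : lyapunov ws ys k <= C by exact: lyapunov_nonincreasing.
have ySC k : S (-1) (y k.+1) (y k.+1) <= C.
  apply: le_trans (lyC k); have := lyapunov_step ws ys k.
  have := lyapunov_ge0 ws ys k.+1; have := edge_form_ge0 ip E 1 (y k.+1 - y k).
  have : 0 <= 4 / rho * monotonicity_gap ws ys k by rewrite mulr_ge0 // divr_ge0 // ltW.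
  by lra.
have [l hl] : exists l : 'cV[R]_m, (fun k => y k.+1 i0 - ys) @ U --> l.
  apply: (@ultra_bounded_cvg _ ip _ _ _ _ _ (C + C)); apply: nearW => k.
  by apply: le_trans (dist_le_lyapunov ws ys k i0) _; exact: lerD.
pose ybar := l + ys.
have yU i : (fun k => y k.+1 i) @ U --> ybar.
  have [c c0 hc] := @connect_dist_le R N m ip E _ _ (connE i i0).
  have -> : (fun k => y k.+1 i) =
      (fun k => (y k.+1 i - y k.+1 i0) + (y k.+1 i0 - ys) + ys).
    by apply/funext => k; rewrite subrKA subrK.
  have h1 : (fun k => y k.+1 i - y k.+1 i0) @ \oo --> (0 : 'cV[R]_m).
    have h0 : (fun k => c * S (-1) (y k.+1) (y k.+1)) @ \oo --> 0.
      by rewrite -(mulr0 c); exact: cvgMr.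
    apply: (@cvg_ip_sq0 _ ip); apply: cvg0_le h0 => k.
    rewrite subr0 ip_ge0 /=; apply: hc; first exact: edge_form_ge0.
    by move=> a b Eab; rewrite -(scaleN1r (y _ b)); exact: edge_term_le.
  rewrite /ybar -[l]add0r; apply: cvgD; last exact: cvg_cst.
  by apply: cvgD; [exact: (cvgU _ _ _ h1)|exact: hl].
(* The Laplacian form controls [w - ws] only up to a common constant, so the value at [i0] is
   subtracted before taking limits. *)
pose W k i := (w k.+2 - ws) i - (w k.+2 - ws) i0.
have hW i : exists L : 'cV[R]_m, (fun k => W k i) @ U --> L.
  have [c c0 hc] := @connect_dist_le R N m ip E _ _ (connE i i0).
  apply: (@ultra_bounded_cvg _ ip _ _ _ _ _ (c * C)); apply: nearW => k.
  apply: le_trans (ler_wpM2l c0 (lyC k.+1)).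
  apply: hc => [|a b Eab]; first exact: lyapunov_ge0.
  have := edge_term_le ip (-1) (w k.+2 - ws) Eab; rewrite scaleN1r => h.
  by apply: le_trans h _; rewrite lerDl edge_form_ge0.
have [L hL] := choice hW.
pose wbar := L + ws.
have wU : (fun k => S (-1) (w k.+2 - wbar) (w k.+2 - wbar)) @ U --> 0.
  have -> : (fun k => S (-1) (w k.+2 - wbar) (w k.+2 - wbar)) =
      (fun k => S (-1) (W k - L) (W k - L)).
    apply/funext => k; apply: eq_bigr => i _; apply: eq_bigr => j _.
    congr (ip m _ _); rewrite /W /wbar !fctE; apply/colP => a; rewrite !mxE; ring.
  have <- : S (-1) (L - L) (L - L) = 0.
    rewrite /edge_form big1 // => i _; rewrite big1 // => j _.
    by rewrite !fctE !subrr scaler0 addr0 ip0l.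
  by apply: edge_form_cvg => i; apply: cvgB; [exact: hL|exact: cvg_cst].
have vU i := v_cvg (i := i) wU (cvgU _ _ _ dyS0).
(* Pairwise monotonicity between steps [k] and [l], with [l] sent to its limit along [U]. *)
have gap_bar k : 0 <= monotonicity_gap wbar ybar k.
  apply: sumr_ge0 => i _.
  have h : (fun l => ip m (v k i - v l i) (y k.+1 i - y l.+1 i)) @ U -->
      ip m (v k i - vstar wbar i) (y k.+1 i - ybar).
    apply: cvg_ip; (apply: cvgB; first exact: cvg_cst); first exact: vU.
    exact: yU.
  by apply: cvgr_to_ge h _; apply: nearW.
have lyU : (fun k => lyapunov wbar ybar k.+1) @ U --> 0.
  rewrite -[X in _ --> X]addr0; apply: cvgD; first exact: wU.
  have <- : S 1 (cst ybar - cst ybar) (cst ybar - cst ybar) = 0.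
    rewrite /edge_form big1 // => i _; rewrite big1 // => j _.
    by rewrite !fctE !subrr scaler0 addr0 ip0l.
  by apply: edge_form_cvg => i; apply: cvgB; [exact: yU|exact: cvg_cst].
(* By monotonicity the Lyapunov function already has a limit along [\oo]; the ultrafilter identifies
   it as 0. *)
have ly0 : (fun k => lyapunov wbar ybar k.+1) @ \oo --> 0.
  have := lyapunov_cvg gap_bar; rewrite -[in X in X -> _]cvg_shiftS => h.
  by rewrite (cvg_unique _ lyU (cvgU _ _ _ h)).
exists ybar, (vstar wbar); split => [|i|i]; first exact: vstar_sum0.
- rewrite -(cvg_shiftS (fun k => y k i)); apply: (@cvg_ip_sq0 _ ip).
  have h0 : (fun k => lyapunov wbar ybar k.+1 + S (-1) (y k.+1) (y k.+1)) @ \oo --> 0.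
    by rewrite -[X in _ --> X]addr0; exact: cvgD.
  by apply: cvg0_le h0 => k; rewrite ip_ge0 dist_le_lyapunov.
- apply: v_cvg => //; apply: cvg0_le ly0 => k.
  by rewrite edge_form_ge0 lerDl edge_form_ge0.
Qed.

End DecentralizedADMM.

(** * First-order conditions and polar cones *)

Lemma quadratic_ge0_coef {R : realFieldType} (p q : R) :
  (forall a, 0 < a <= 1 -> 0 <= a * p + a ^+ 2 * q) -> 0 <= p.
Proof.
move=> h; rewrite leNgt; apply/negP => p0.
have q0 : 0 < q - p by have := h 1 ltac:(lra); nra.
(* When [p < 0], the case [a = 1] gives [q >= - p > 0]. This value lies halfway between 0 and
   [- p / (q - p)], and makes [p + a * q] negative. *)
have a01 : 0 < - p / (q - p) / 2 <= 1.
  apply/andP; split; first by rewrite !divr_gt0 // oppr_gt0.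
  rewrite ler_pdivrMr // ler_pdivrMr //.
  have := h 1 ltac:(lra); nra.
have := h _ a01; set a := - p / _ / _ in a01 *.
have : a * (2 * (q - p)) = - p by rewrite /a; field; rewrite gt_eqF.
case/andP: a01 => a0 a1 e; rewrite expr2 -mulrA -mulrDr pmulr_rge0 //.
nra.
Qed.

Section ConvexDuality.
Context {R : realType}.
Variable ip : forall n : nat, {dot 'cV[R]_n for idfun}.

Lemma cone_addr_closed {m} (K : set 'cV[R]_m) x y :
  convex_set K -> is_cone K -> K x -> K y -> K (x + y).
Proof.
move=> cK coneK Kx Ky.
have h0 : 0 <= (2^-1 : R) by lra.
have h1 : (2^-1 : R) <= 1 by lra.
have h : K (2^-1 *: x + (1 - 2^-1) *: y).
  by have := cK x y (Itv01 h0 h1); rewrite !inE; exact.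
have -> : x + y = 2 *: (2^-1 *: x + (1 - 2^-1) *: y).
  by apply/colP => a; rewrite !mxE; field.
by apply: coneK.
Qed.

Lemma polar_coneP {m} (K : set 'cV[R]_m) y :
  polar_cone ip K y <-> forall x, K x -> ip m x y <= 0.
Proof.
split=> [/ereal_supP h x Kx|h]; first by rewrite -lee_fin; apply: h; exists x.
by apply/ereal_supP => _ [x Kx <-]; rewrite lee_fin; exact: h.
Qed.

(* [- adjoint A u] is a subgradient of f at x, where f takes the value phi. *)
Definition stationary {n m} (f : 'cV[R]_n -> \bar R) (A : 'M[R]_(m, n))
    (x : 'cV[R]_n) (phi : R) (u : 'cV[R]_m) :=
  f x = phi%:E /\ forall z, ((phi - ip m u (A *m (z - x)))%:E <= f z)%E.

Lemma stationary_monotone {n m} f (A : 'M[R]_(m, n)) x x' phi phi' u u' :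
  stationary f A x phi u -> stationary f A x' phi' u' ->
  0 <= ip m (u - u') (A *m (x' - x)).
Proof.
move=> [fx h] [fx' h']; have := h x'; have := h' x; rewrite fx fx' !lee_fin.
by rewrite -(opprB x' x) mulmxN !ipE; lra.
Qed.

(* The first-order conditions of the update in x and in t. *)
Lemma prox_optimality {n m} (f : 'cV[R]_n -> \bar R) (A : 'M[R]_(m, n))
    (K : set 'cV[R]_m) (r t : 'cV[R]_m) (x : 'cV[R]_n) (c : R) :
  convex_fun f -> proper_fun f -> K !=set0 -> convex_set K -> is_cone K ->
  0 < c ->
  argmin_on [set: 'cV[R]_n * 'cV[R]_m]
    (fun z => f z.1 + indicator K z.2
       + (c * ipnorm ip (A *m z.1 + r - z.2) ^+ 2)%:E)%E (x, t) ->
  [/\ K t, polar_cone ip K (A *m x + r - t), ip m (A *m x + r - t) t = 0 &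
    exists phi, stationary f A x phi ((2 * c) *: (A *m x + r - t))].
Proof.
move=> cf [fN [x0 fx0]] [t0 Kt0] cK coneK c0 [_ /= xt_min].
move dE : (A *m x + r - t) xt_min => d xt_min.
have KE z : K z -> indicator K z = 0%E :> \bar R by move=> Kz; rewrite /indicator mem_set.
(* Comparison with a point where the objective is finite excludes the value [+oo] at the
   minimizer. *)
have [phi fx] : exists phi, f x = phi%:E.
  have := xt_min (x0, t0) I; rewrite /= (KE _ Kt0) adde0.
  case: (f x0) (fN x0) fx0 => [a| |] //= _ _.
  case: (f x) (fN x) => [a' _ _| |] //; first by exists a'.
  by rewrite /indicator; case: ifP.
have Kt : K t.
  apply/set_mem; have := xt_min (x0, t0) I; rewrite /= (KE _ Kt0) adde0 fx.
  case: (f x0) (fN x0) fx0 => [a| |] //= _ _; rewrite /indicator.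
  by case: ifP.
have xtE z s a : K s -> f z = a%:E ->
    phi + c * ip m d d <= a + c * ip m (A *m z + r - s) (A *m z + r - s).
  move=> Ks fz; have := xt_min (z, s) I.
  by rewrite /= fx fz !KE // !adde0 !ipnorm_sq -!EFinD lee_fin.
have K0 : K 0 by rewrite -(scale0r t0); exact: coneK.
(* Moving [t] towards [s] stays in [K] by convexity; the linear coefficient of the change in the
   objective must be nonnegative. *)
have dir s : K s -> ip m d (s - t) <= 0.
  move=> Ks; rewrite -oppr_ge0.
  have : 0 <= 2 * c * - ip m d (s - t).
    apply: (@quadratic_ge0_coef _ _ (c * ip m (s - t) (s - t))) => a a01.
    have Ksa : K (a *: s + (1 - a) *: t).
      by apply: cone_addr_closed => //; apply: coneK => //; lra.
    have := xtE x _ _ Ksa fx.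
    have -> : A *m x + r - (a *: s + (1 - a) *: t) = d - a *: (s - t).
      by rewrite -dE; apply/colP => i; rewrite !mxE; ring.
    rewrite !(ipDl, ipDr, ipNl, ipNr, ipZl, ipZr).
    rewrite !(ipC ip _ d) ; nra.
  by rewrite pmulr_rge0 // mulr_gt0.
(* The cone contains [2 *: t] and 0, which test the inequality in both directions along [t]. *)
have dt : ip m d t = 0.
  apply/eqP; rewrite eq_le; apply/andP; split.
    have := dir (2 *: t) (coneK _ _ _ Kt); rewrite ler0n => /(_ isT).
    by rewrite !ipE; lra.
  by have := dir 0 K0; rewrite sub0r ipNr; lra.
split => //.
  apply/polar_coneP => s Ks; have := dir s Ks.
  by rewrite ipDr ipNr dt (ipC ip s d); lra.
exists phi; split => // z.
case fz : (f z) => [b| |]; last by have := fN z; rewrite fz.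
  rewrite lee_fin ipZl -subr_ge0.
  (* The same perturbation for [x], moved towards [z], where convexity bounds the change of [f]
     linearly in [a]. *)
  apply: (@quadratic_ge0_coef _ _ (c * ip m (A *m (z - x)) (A *m (z - x)))) => a a01.
  have := cf z x a; rewrite fz fx => /(_ ltac:(lra)); rewrite -!EFinM -EFinD.
  case fa : (f _) (fN (a *: z + (1 - a) *: x)) => [b'| |] // _.
  rewrite lee_fin; have := xtE _ t _ Kt fa.
  have -> : A *m (a *: z + (1 - a) *: x) + r - t = d + a *: (A *m (z - x)).
    rewrite mulmxDr -!scalemxAr mulmxBr -dE; apply/colP => i; rewrite !mxE; ring.
  rewrite !ipE !(ipC ip _ d); nra.
exact: leey.
Qed.

(** Moreau's decomposition: an orthogonal sum of a polar and a cone element projects onto its polar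
    part. The term in [c - d] in [key] also gives uniqueness, which determines the point chosen by
    [xget]. *)
Lemma projection_polar {m} (K : set 'cV[R]_m) (d t : 'cV[R]_m) :
  K t -> polar_cone ip K d -> ip m d t = 0 ->
  projection ip (polar_cone ip K) (d + t) = d.
Proof.
move=> Kt Kd dt.
have key c : polar_cone ip K c ->
    ip m t t + ip m (c - d) (c - d) <= ip m (d + t - c) (d + t - c).
  move=> /polar_coneP/(_ t Kt) tc.
  have -> : d + t - c = t - (c - d) by apply/colP => i; rewrite !mxE; ring.
  move: tc dt; rewrite !(ipDl, ipDr, ipNl, ipNr) !(ipC ip _ t); lra.
rewrite /projection; case: xgetP => [u _ [Ku umin]|/(_ d)].
  have := umin d Kd; rewrite ler_sqrt ?ip_ge0 //.
  have -> : d + t - d = t by rewrite addrAC subrr add0r.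
  move=> h; have /ip_le0_eq0/eqP : ip m (u - d) (u - d) <= 0.
    by have := key u Ku; lra.
  by rewrite subr_eq0 => /eqP.
case; split => // c Kc; rewrite /ipnorm ler_wsqrtr //.
have -> : d + t - d = t by rewrite addrAC subrr add0r.
by have := key c Kc; have := ip_ge0 ip (c - d); lra.
Qed.

End ConvexDuality.

(** * Zero duality gap and KKT conditions *)

Section OptimalityConditions.
Context {R : realType} {N m : nat} {n : 'I_N -> nat}.
Variable ip : forall n : nat, {dot 'cV[R]_n for idfun}.
Variables (f : forall i, 'cV[R]_(n i) -> \bar R).
Variables (A : forall i, 'M[R]_(m, n i)) (b : 'I_N -> 'cV[R]_m).
Variable K : set 'cV[R]_m.
Implicit Types (x : 'cV[R]_(\sum_i n i)) (u : 'cV[R]_m).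

Definition residual x : 'cV[R]_m := \sum_i (A i *m submxcol x i - b i).

Lemma ip_residual u x :
  ip m u (residual x) =
  \sum_i (ip m u (A i *m submxcol x i) - ip m u (b i)).
Proof. by rewrite ip_sumr; apply: eq_bigr => i _; rewrite ipDr ipNr. Qed.

Lemma fenchel_young {k} (g : 'cV[R]_k -> \bar R) (B : 'M[R]_(m, k)) u z gamma :
  conjugate ip g (- (adjoint ip B *m u)) = gamma%:E ->
  ((- ip m u (B *m z) - gamma)%:E <= g z)%E.
Proof.
move=> hg; have : ((ip k (- (adjoint ip B *m u)) z)%:E - g z <= gamma%:E)%E.
  by rewrite -hg; apply: ereal_sup_ubound; exists z.
rewrite ipNl ipC -adjointP (ipC ip _ u).
case: (g z) => [a| |]; rewrite ?leey //=; rewrite -EFinB !lee_fin; lra.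
Qed.

Lemma primal_value_minimizer x :
  primal_minimizers f A b K x -> primal_value f A b K = primal_objective f x.
Proof.
move=> [Kx xmin]; apply/le_anti/andP; split.
  by apply: ereal_inf_lbound; exists x.
by apply: le_ereal_inf_tmp => _ [z Kz <-]; exact: xmin.
Qed.

Lemma dual_value_maximizer u :
  dual_maximizers ip f A b K u -> dual_value ip f A b K = dual_objective ip f A b K u.
Proof.
move=> [_ umax]; apply/le_anti/andP; split; last first.
  by apply: ereal_sup_ubound; exists u.
by apply: ge_ereal_sup => _ [z _ <-]; exact: umax.
Qed.

(** The Fenchel-Young gaps [e i] are nonnegative, and a zero duality gap makes their sum equal to
    the pairing of [u] with the residual, which is nonpositive. Hence all of them vanish, as does
    the pairing. *)
Lemma zero_gap_kkt (i0 : 'I_N) x u :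
  (forall i, proper_fun (@f i)) ->
  primal_minimizers f A b K x -> dual_maximizers ip f A b K u ->
  primal_value f A b K = dual_value ip f A b K ->
  [/\ polar_cone ip K u, ip m u (residual x) = 0 &
    exists phi, forall i, stationary ip (@f i) (A i) (submxcol x i) (phi i) u].
Proof.
move=> fP xP uP; rewrite (primal_value_minimizer xP) (dual_value_maximizer uP).
rewrite /dual_objective => gap.
pose g i := conjugate ip (@f i) (- (adjoint ip (A i) *m u)).
have gN i : g i != -oo%E.
  have [fN [z fz]] := fP i; rewrite -ltNye.
  apply: (@lt_le_trans _ _ ((ip _ (- (adjoint ip (A i) *m u)) z)%:E - f z)%E); last first.
    by apply: ereal_sup_ubound; exists z.
  by case: (f z) (fN z) fz => [a| |] // _ _; rewrite -EFinB ltNyr.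
have indN : indicator (R:=R) (polar_cone ip K) u != -oo%E.
  by rewrite /indicator; case: ifP.
have dN i : (g i + (ip m u (b i))%:E + indicator (R:=R) (polar_cone ip K) u)%E != -oo%E.
  by rewrite !adde_eq_ninfty !negb_or gN indN.
have fN i : f (submxcol x i) != -oo%E by have [fN _] := fP i.
(* The primal sum cannot be [-oo] and the negated dual sum cannot be [+oo]; being equal, both are
   finite. *)
have pfin : primal_objective f x \is a fin_num.
  apply/fin_numP; split.
    by apply/eqP => /esum_eqNyP[i [_ _ /eqP]]; rewrite (negbTE (fN i)).
  rewrite gap; apply/eqP => /(congr1 (fun e => - e)%E); rewrite oppeK /=.
  by move=> /esum_eqNyP[i [_ _ /eqP]]; rewrite (negbTE (dN i)).
have /sum_fin_numP ffin := pfin.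
have := pfin; rewrite gap fin_numN => /sum_fin_numP dfin.
have ind_fin : indicator (R:=R) (polar_cone ip K) u \is a fin_num.
  by have := dfin i0 (mem_index_enum _) isT; rewrite !fin_numD => /andP[].
have Ku : polar_cone ip K u.
  by apply/set_mem; move: ind_fin; rewrite /indicator; case: ifP.
have ind0 : indicator (R:=R) (polar_cone ip K) u = 0%E.
  by rewrite /indicator mem_set.
have [phi hphi] : exists phi : 'I_N -> R, forall i, f (submxcol x i) = (phi i)%:E.
  exists (fun i => fine (f (submxcol x i))) => i.
  by rewrite fineK // ffin // mem_index_enum.
have [gam hgam] : exists gam : 'I_N -> R, forall i, g i = (gam i)%:E.
  exists (fun i => fine (g i)) => i; rewrite fineK //.
  by have := dfin i (mem_index_enum _) isT; rewrite !fin_numD => /andP[/andP[]].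
have gapR : \sum_i phi i = - \sum_i (gam i + ip m u (b i)).
  apply/EFin_inj; rewrite EFinN -!sumEFin.
  move: gap; rewrite /primal_objective.
  under eq_bigr do rewrite hphi.
  move=> ->; congr (- _)%E; apply: eq_bigr => i _.
  by rewrite ind0 adde0 -/(g i) hgam EFinD.
pose e i := phi i + gam i + ip m u (A i *m submxcol x i).
have e0 i : 0 <= e i.
  have := fenchel_young (submxcol x i) (hgam i); rewrite hphi lee_fin /e; lra.
have esum : \sum_i e i = ip m u (residual x).
  rewrite ip_residual /e !big_split /= gapR sumrN big_split /=; ring.
have ux0 : ip m u (residual x) <= 0.
  by have [Kx _] := xP; rewrite ipC; exact: (polar_coneP ip K u).1 Ku _ Kx.
have s0 : \sum_i e i = 0.
  by apply/le_anti/andP; split; [rewrite esum|exact: sumr_ge0].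
split => //; first by rewrite -esum.
exists phi => i; split => // z.
have ei0 : e i = 0.
  by apply/eqP; move/eqP: s0; rewrite psumr_eq0 // => /allP/(_ i); apply; exact: mem_index_enum.
apply: le_trans (fenchel_young z (hgam i)).
by rewrite lee_fin mulmxBr ipDr ipNr; move: ei0; rewrite /e; lra.
Qed.

(** The zero gap bounds every dual value by the primal optimum, so it suffices that [u] attains it.
    Stationarity bounds each conjugate from above, and complementarity cancels the remaining
    terms. *)
Lemma kkt_dual_maximizer x u (phi : 'I_N -> R) :
  primal_minimizers f A b K x ->
  primal_value f A b K = dual_value ip f A b K ->
  polar_cone ip K u -> ip m u (residual x) = 0 ->
  (forall i, stationary ip (@f i) (A i) (submxcol x i) (phi i) u) ->
  dual_maximizers ip f A b K u.
Proof.
move=> xP gap Ku ux st; split=> // z _.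
have zp : (dual_objective ip f A b K z <= primal_objective f x)%E.
  by rewrite -(primal_value_minimizer xP) gap; apply: ereal_sup_ubound; exists z.
apply: le_trans zp _; rewrite /dual_objective leeNr.
have -> : primal_objective f x = (\sum_i phi i)%:E.
  by rewrite -sumEFin; apply: eq_bigr => i _; have [] := st i.
have -> : (- (\sum_i phi i)%:E)%E =
    (\sum_i (- phi i - ip m u (A i *m submxcol x i) + ip m u (b i)))%:E.
  rewrite -EFinN; congr (_%:E); move: ux; rewrite ip_residual sumrB !big_split /=.
  rewrite !sumrN; lra.
rewrite -sumEFin; apply: lee_sum => i _.
have -> : indicator (R:=R) (polar_cone ip K) u = 0%E by rewrite /indicator mem_set.
rewrite adde0 EFinD leeD2r //; apply: ge_ereal_sup => _ [z' _ <-].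
have [_ /(_ z')] := st i.
rewrite ipNl (ipC ip _ z') -adjointP (ipC ip _ u) mulmxBr ipDr ipNr.
case: (f z') => [a| |]; rewrite ?leNye //= -?EFinB ?lee_fin; lra.
Qed.

End OptimalityConditions.

(** * Cluster points as ultrafilter limits *)

Lemma cluster_ultra {I : Type} {T : topologicalType} (F : set_system I)
    {FF : ProperFilter F} (u : I -> T) (l : T) :
  cluster (u @ F) l -> exists U, [/\ UltraFilter U, F `<=` U & u @ U --> l].
Proof.
move=> ul; pose D : set (set I * set T) := [set B | F B.1 /\ nbhs l B.2].
pose base (B : set I * set T) := B.1 `&` u @^-1` B.2.
(* The sets meeting [F] with preimages of neighborhoods of [l] form a filter base, proper because
   [l] is a cluster point. *)
have GF : Filter (filter_from D base).
  apply: filter_from_filter; first by exists (setT, setT); split; exact: filterT.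
  move=> B C [FB lB] [FC lC]; exists (B.1 `&` C.1, B.2 `&` C.2).
    by split; exact: filterI.
  by move=> k [[? ?] [? ?]].
have GP : ProperFilter (filter_from D base).
  apply: filter_from_proper => B [FB lB].
  have FuB : F (u @^-1` (u @` B.1)) by apply: filterS FB => k Bk; exists k.
  by have [_ [[k Bk <-] uBk]] := ul (u @` B.1) B.2 FuB lB; exists k.
have [U [UU GU]] := ultraFilterLemma GP.
exists U; split => // B BB; apply: GU.
  by exists (B, setT) => [|k [] //]; split => //; exact: filterT.
by exists (setT, B) => [|k [] //]; split => //; exact: filterT.
Qed.

Lemma cvg_submxcol {R : realType} {I : Type} {F : set_system I} {FF : Filter F}
    {N : nat} {n : 'I_N -> nat} (u : I -> 'cV[R]_(\sum_i n i)) (l : 'cV[R]_(\sum_i n i)) i :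
  u @ F --> l -> (fun k => submxcol (u k) i) @ F --> submxcol l i.
Proof.
move=> ul; apply: cvg_col => j; rewrite mxE.
under eq_cvg do rewrite mxE.
exact: cvg_coord.
Qed.

(** * Optimality of the limits *)

Section PrimalDualLimits.
Context {R : realType} {N m : nat} {n : 'I_N -> nat}.
Variable ip : forall n : nat, {dot 'cV[R]_n for idfun}.
Variables (f : forall i, 'cV[R]_(n i) -> \bar R).
Variables (A : forall i, 'M[R]_(m, n i)) (b : 'I_N -> 'cV[R]_m).
Variable K : set 'cV[R]_m.
Hypotheses (closedK : closed K) (convexK : convex_set K) (coneK : is_cone K).

Variables (x : nat -> forall i, 'cV[R]_(n i)) (t y v : nat -> 'I_N -> 'cV[R]_m).
Variable phi : nat -> 'I_N -> R.
Hypothesis tK : forall k i, K (t k i).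
Hypothesis yK : forall k i, polar_cone ip K (y k i).
Hypothesis yt0 : forall k i, ip m (y k i) (t k i) = 0.
Hypothesis xy_stat : forall k i, stationary ip (@f i) (A i) (x k i) (phi k i) (y k i).
Hypothesis vE : forall k i, v k i = b i + t k i - A i *m x k i.

Variables (xs : 'cV[R]_(\sum_i n i)) (us : 'cV[R]_m) (phis : 'I_N -> R).
Hypothesis resK : K (residual A b xs).
Hypothesis usK : polar_cone ip K us.
Hypothesis us_res : ip m us (residual A b xs) = 0.
Hypothesis xs_stat :
  forall i, stationary ip (@f i) (A i) (submxcol xs i) (phis i) us.

(** Equal splitting of the coupled constraint: each node receives a slack in [K], the counterpart of
    its [t] at the solution. *)
Definition residual_share : 'cV[R]_m := N%:R^-1 *: residual A b xs.

(** The counterpart of [v] at the solution. Its zero sum puts it in the range of the Laplacian. *)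
Definition share_dual (i : 'I_N) : 'cV[R]_m :=
  b i + residual_share - A i *m submxcol xs i.

Lemma residual_shareK : K residual_share.
Proof. by apply: coneK => //; rewrite invr_ge0 ler0n. Qed.

Lemma residual_share_sum (i0 : 'I_N) : \sum_(i < N) residual_share = residual A b xs.
Proof.
rewrite sumr_const card_ord -scaler_nat scalerA divff ?scale1r // pnatr_eq0.
by rewrite -lt0n (leq_ltn_trans _ (ltn_ord i0)).
Qed.

Lemma share_dual_sum (i0 : 'I_N) : \sum_i share_dual i = 0.
Proof.
rewrite /share_dual; under eq_bigr do rewrite addrAC.
rewrite big_split /= (residual_share_sum i0) /residual -big_split big1 // => i _.
by rewrite /= addrA subrK subrr.
Qed.

(** The pairing splits into the monotonicity of the subdifferential of [f i] and a cone part, where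
    complementarity leaves only cross terms of polar sign. *)
Lemma dual_monotone k l i : 0 <= ip m (v k i - v l i) (y k i - y l i).
Proof.
have -> : v k i - v l i = A i *m (x l i - x k i) + (t k i - t l i).
  by rewrite !vE mulmxBr; apply/colP => a; rewrite !mxE; ring.
have h1 := stationary_monotone (xy_stat k i) (xy_stat l i).
rewrite ipC ipDr addr_ge0 // !ipE !yt0.
have := (polar_coneP ip K _).1 (yK k i) _ (tK l i).
have := (polar_coneP ip K _).1 (yK l i) _ (tK k i).
by rewrite !(ipC ip (t _ _)); lra.
Qed.

(** Each of the three parts is nonnegative, so a vanishing gap forces each to vanish separately. *)
Lemma gap_split k i : ip m (v k i - share_dual i) (y k i - us) =
  ip m (y k i - us) (A i *m (submxcol xs i - x k i))
  + (- ip m us (t k i)) + (- ip m residual_share (y k i)).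
Proof.
have -> : v k i - share_dual i =
    A i *m (submxcol xs i - x k i) + (t k i - residual_share).
  by rewrite vE /share_dual mulmxBr; apply/colP => a; rewrite !mxE; ring.
rewrite ipC ipDr -addrA; congr (_ + _).
by rewrite /residual_share !ipE yt0 us_res (ipC ip (residual _ _ _)); ring.
Qed.

Lemma gap_parts_ge0 k i :
  [/\ 0 <= ip m (y k i - us) (A i *m (submxcol xs i - x k i)),
      0 <= - ip m us (t k i) & 0 <= - ip m residual_share (y k i)].
Proof.
split; first exact: stationary_monotone (xy_stat k i) (xs_stat i).
  by rewrite oppr_ge0 ipC; exact: (polar_coneP ip K _).1 usK _ (tK k i).
by rewrite oppr_ge0; exact: (polar_coneP ip K _).1 (yK k i) _ residual_shareK.
Qed.

Lemma gap_term_ge0 k i : 0 <= ip m (v k i - share_dual i) (y k i - us).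
Proof. by have [? ? ?] := gap_parts_ge0 k i; rewrite gap_split !addr_ge0. Qed.

Variable ybar : 'cV[R]_m.
Hypothesis y_cvg : forall i, (fun k => y k i) @ \oo --> ybar.

Section DualLimit.
Hypothesis gap0 :
  (fun k => \sum_i ip m (v k i - share_dual i) (y k i - us)) @ \oo --> 0.

Let gap_term_cvg0 i : (fun k => ip m (v k i - share_dual i) (y k i - us)) @ \oo --> 0.
Proof.
apply: cvg0_le gap0 => k; rewrite gap_term_ge0 (bigD1 i) //= lerDl.
by apply: sumr_ge0 => j _; exact: gap_term_ge0.
Qed.

Lemma limit_polar (i0 : 'I_N) : polar_cone ip K ybar.
Proof.
apply/polar_coneP => z Kz.
have h : (fun k => ip m z (y k i0)) @ \oo --> ip m z ybar.
  by apply: cvg_ip; [exact: cvg_cst|exact: y_cvg].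
apply: (cvgr_to_le h); apply: nearW => k.
exact: (polar_coneP ip K _).1 (yK k i0) _ Kz.
Qed.

Lemma limit_complementary (i0 : 'I_N) : ip m ybar (residual A b xs) = 0.
Proof.
have h : (fun k => - ip m residual_share (y k i0)) @ \oo --> - ip m residual_share ybar.
  by apply: cvgN; apply: cvg_ip; [exact: cvg_cst|exact: y_cvg].
have h0 : (fun k => - ip m residual_share (y k i0)) @ \oo --> 0.
  apply: cvg0_le (gap_term_cvg0 i0) => k.
  by have [? ? ->] := gap_parts_ge0 k i0; rewrite gap_split lerDr addr_ge0.
have e : ip m residual_share ybar = 0.
  by apply: oppr_inj; rewrite oppr0; exact: cvg_unique _ h h0.
by rewrite -(residual_share_sum i0) ip_sumr big1 // => i _; rewrite ipC.
Qed.

(** No limit of [x] is involved: chaining the subgradient inequality at [xs], tested at [x k i],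
    with the one at [x k i], tested at [z], gives the claim for [y k i] up to the error [G k], which
    tends to 0. *)
Lemma limit_stationary i :
  stationary ip (@f i) (A i) (submxcol xs i) (phis i) ybar.
Proof.
have [fxs xs_sub] := xs_stat i; split => // z.
have [fN|] := eqVneq (f z) -oo%E.
  by have [_ /(_ z)] := xy_stat 0 i; rewrite fN.
case fz : (f z) => [a| |] // _; last exact: leey.
rewrite lee_fin.
pose G k := ip m (y k i - us) (A i *m (submxcol xs i - x k i)).
have G0 : G @ \oo --> 0.
  apply: cvg0_le (gap_term_cvg0 i) => k.
  by have [-> ? ?] := gap_parts_ge0 k i; rewrite gap_split -addrA lerDl addr_ge0.
have h : (fun k => phis i - ip m (y k i) (A i *m (z - submxcol xs i)) - G k) @ \oo -->
    phis i - ip m ybar (A i *m (z - submxcol xs i)) - 0.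
  apply: cvgB G0; apply: cvgB; first exact: cvg_cst.
  by apply: cvg_ip; [exact: y_cvg|exact: cvg_cst].
rewrite -[leLHS]subr0; apply: (cvgr_to_le h); apply: nearW => k.
have [fx /(_ z)] := xy_stat k i; rewrite fz lee_fin.
have := xs_sub (x k i); rewrite fx lee_fin /G.
by rewrite !mulmxBr !ipE; lra.
Qed.

End DualLimit.

Lemma limit_primal_minimizer (vbar : 'I_N -> 'cV[R]_m)
    (xbar : 'cV[R]_(\sum_i n i)) :
  (forall i, closed_fun (@f i)) ->
  (forall i, (fun k => v k i) @ \oo --> vbar i) -> \sum_i vbar i = 0 ->
  ip m ybar (residual A b xs) = 0 ->
  primal_minimizers f A b K xs ->
  cluster ((fun k => \mxcol_i x k i) @ \oo) xbar ->
  primal_minimizers f A b K xbar.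
Proof.
move=> closedf v_cvg vbar0 ybar_res [_ xs_min] /cluster_ultra[U [UU ooU xU]].
have cvgU (T : topologicalType) (u : nat -> T) (l : T) : u @ \oo --> l -> u @ U --> l.
  by move=> ul B /ul; exact: ooU.
have xiU i : (fun k => x k i) @ U --> submxcol xbar i.
  have -> : (fun k => x k i) = (fun k => submxcol (\mxcol_i x k i) i).
    by apply/funext => k; rewrite mxcolK.
  exact: cvg_submxcol.
have yU i := cvgU _ _ _ (y_cvg i).
pose tbar i := vbar i - b i + A i *m submxcol xbar i.
have tU i : (fun k => t k i) @ U --> tbar i.
  have -> : (fun k => t k i) = (fun k => v k i - b i + A i *m x k i).
    by apply/funext => k; rewrite vE; apply/colP => a; rewrite !mxE; ring.
  apply: cvgD; last exact: cvg_mulmx.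
  by apply: cvgB; [exact: cvgU (v_cvg i)|exact: cvg_cst].
(* Since the [vbar i] sum to 0, the limits of the slacks add up to the residual of [xbar]; this
   yields feasibility. *)
have tbar_sum : \sum_i tbar i = residual A b xbar.
  rewrite /tbar /residual; under eq_bigr do rewrite -addrA.
  rewrite big_split /= vbar0 add0r; apply: eq_bigr => i _; exact: addrC.
have tbarK i : K (tbar i).
  by apply: (closed_cvg _ closedK _ _ (tU i)); apply: nearW.
have ybar_tbar i : ip m ybar (tbar i) = 0.
  have h : (fun k => ip m (y k i) (t k i)) @ U --> ip m ybar (tbar i) by exact: cvg_ip.
  have h0 : (fun k => ip m (y k i) (t k i)) @ U --> 0.
    by under eq_cvg do rewrite yt0; exact: cvg_cst.
  exact: cvg_unique _ h h0.
(* Stationarity at the iterate and at [xs] encloses [phi k i] between convergent bounds, so it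
   converges along [U]. *)
pose hi i k := phis i + ip m (y k i) (A i *m (submxcol xs i - x k i)).
pose lo i k := phis i - ip m us (A i *m (x k i - submxcol xs i)).
pose hibar i := phis i + ip m ybar (A i *m (submxcol xs i - submxcol xbar i)).
have hiU i : hi i @ U --> hibar i.
  apply: cvgD; first exact: cvg_cst.
  by apply: cvg_ip => //; apply: cvg_mulmx; apply: cvgB; [exact: cvg_cst|exact: xiU].
have loU i : lo i @ U --> phis i - ip m us (A i *m (submxcol xbar i - submxcol xs i)).
  apply: cvgB; first exact: cvg_cst.
  apply: cvg_ip; first exact: cvg_cst.
  by apply: cvg_mulmx; apply: cvgB; [exact: xiU|exact: cvg_cst].
have phi_hi i k : phi k i <= hi i k.
  have [fx /(_ (submxcol xs i))] := xy_stat k i; have [-> _] := xs_stat i.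
  by rewrite lee_fin lerBlDr.
have phi_lo i k : lo i k <= phi k i.
  by have [fx _] := xy_stat k i; have := (xs_stat i).2 (x k i); rewrite fx lee_fin.
have phiU i : exists l : R, (fun k => phi k i) @ U --> l.
  apply: (@ultra_bounded_cvgr _ _ _ _ _
    (phis i - ip m us (A i *m (submxcol xbar i - submxcol xs i)) - 1) (hibar i + 1)).
  have h1 : \forall k \near U, hi i k <= hibar i + 1.
    by apply: cvgr_le (hiU i) _ _; rewrite ltrDl.
  have h2 : \forall k \near U,
      phis i - ip m us (A i *m (submxcol xbar i - submxcol xs i)) - 1 <= lo i k.
    by apply: cvgr_ge (loU i) _ _; rewrite gtrBl.
  apply: filterS2 h1 h2 => k hk lk.
  by rewrite (le_trans lk (phi_lo i k)) (le_trans (phi_hi i k) hk).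
have [phibar phibarU] := choice phiU.
have f_le i : (f (submxcol xbar i) <= (phibar i)%:E)%E.
  have h : (fun k => (x k i, phi k i)) @ U --> (submxcol xbar i, phibar i).
    exact: (cvg_pair (xiU i) (phibarU i)).
  have : epigraph (@f i) (submxcol xbar i, phibar i); last by [].
  apply: (closed_cvg _ (closedf i) _ _ h); apply: nearW => k.
  by rewrite /epigraph /=; have [-> _] := xy_stat k i.
have phibar_le i : phibar i <= hibar i.
  by apply: (ler_cvg_to (phibarU i) (hiU i)); apply: nearW.
(* Complementarity of [ybar] with both residuals removes the linear terms, leaving the optimal
   value. *)
have hibar_sum : \sum_i hibar i = \sum_i phis i.
  rewrite /hibar big_split /= -ip_sumr -[RHS]addr0; congr (_ + _).
  have -> : \sum_i A i *m (submxcol xs i - submxcol xbar i) =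
      residual A b xs - \sum_i tbar i.
    rewrite tbar_sum /residual -sumrB; apply: eq_bigr => i _.
    by rewrite mulmxBr opprB addrA subrK.
  by rewrite ipDr ipNr ybar_res ip_sumr big1 ?subrr // => i _; exact: ybar_tbar.
split.
  rewrite /primal_feasible /= -/(residual A b xbar) -tbar_sum.
  apply: (big_ind K) => // [|z z' Kz Kz']; last exact: cone_addr_closed.
  by rewrite -(scale0r (residual A b xs)); exact: coneK.
move=> z Kz; apply: le_trans (xs_min z Kz).
apply: (@le_trans _ _ (\sum_i (phibar i)%:E)%E); first exact: lee_sum.
rewrite sumEFin (_ : primal_objective f xs = (\sum_i phis i)%:E); last first.
  by rewrite -sumEFin; apply: eq_bigr => i _; have [] := xs_stat i.
by rewrite lee_fin -hibar_sum; exact: ler_sum.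
Qed.

End PrimalDualLimits.

(** * The algorithm as an instance of the recursion *)

Theorem proposition1 (R : realType)
    (ip : forall n : nat, {dot 'cV[R]_n for idfun})
    (N m : nat) (n : 'I_N -> nat) (E : rel 'I_N)
    (f : forall i : 'I_N, 'cV[R]_(n i) -> \bar R)
    (A : forall i : 'I_N, 'M[R]_(m, n i)) (b : 'I_N -> 'cV[R]_m)
    (K : set 'cV[R]_m) (rho : R)
    (p r t y : nat -> 'I_N -> 'cV[R]_m)
    (x : nat -> forall i : 'I_N, 'cV[R]_(n i)) :
  (0 < N)%N ->
  symmetric E ->
  connected_graph E ->
  (forall i, (1 <= degree E i)%N) ->
  (forall i, convex_fun (@f i) /\ closed_fun (@f i) /\ proper_fun (@f i)) ->
  K !=set0 -> closed K -> convex_set K -> is_cone K ->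
  primal_minimizers f A b K !=set0 ->
  dual_maximizers ip f A b K !=set0 ->
  primal_value f A b K = dual_value ip f A b K ->
  0 < rho ->
  (forall i, p 0%N i = 0) ->
  (forall k i,
    p k.+1 i = p k i + rho *: \sum_(j in neighbors E i) (y k i - y k j)) ->
  (forall k i,
    r k.+1 i = rho *: (\sum_(j in neighbors E i) (y k i + y k j))
               - (b i + p k.+1 i)) ->
  (forall k i,
    argmin_on [set: 'cV[R]_(n i) * 'cV[R]_m]
      (fun z => f i z.1 + indicator K z.2
        + ((4 * rho * (degree E i)%:R)^-1
           * ipnorm ip (A i *m z.1 + r k.+1 i - z.2) ^+ 2)%:E)%E
      (x k.+1 i, t k.+1 i)) ->
  (forall k i,
    y k.+1 i = (2 * rho * (degree E i)%:R)^-1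
      *: projection ip (polar_cone ip K) (A i *m x k.+1 i + r k.+1 i)) ->
  (exists2 ystar, dual_maximizers ip f A b K ystar &
    forall i, (fun k => y k i) @ \oo --> ystar) /\
  (forall xbar : 'cV[R]_(\sum_i n i),
    cluster ((fun k => \mxcol_i x k i) @ \oo) xbar ->
    primal_minimizers f A b K xbar).
Proof.
move=> N0 symE connE degE fP K0 closedK convexK coneK [xs xsP] [us usP] gap rho0
  p0 pE rE argminE yE.
pose i0 : 'I_N := Ordinal N0.
have deg0 i : 0 < (degree E i)%:R :> R by rewrite ltr0n degE.
have f_proper i : proper_fun (@f i) by have [_ []] := fP i.
have [usK us_res [phis xs_stat]] := zero_gap_kkt i0 f_proper xsP usP gap.
have resK : K (residual A b xs) by have [Kx _] := xsP.
(* Everything is indexed from step 1, since [x 0], [t 0] and [y 0] satisfy no optimality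
   condition. *)
pose d k i := A i *m x k.+1 i + r k.+1 i - t k.+1 i.
have prox k i : [/\ K (t k.+1 i), polar_cone ip K (d k i), ip m (d k i) (t k.+1 i) = 0 &
    exists phi, stationary ip (@f i) (A i) (x k.+1 i) phi
      ((2 * (4 * rho * (degree E i)%:R)^-1) *: d k i)].
  apply: prox_optimality (argminE k i) => //; first by have [] := fP i.
  by rewrite invr_gt0 !mulr_gt0.
have ydE k i : y k.+1 i = (2 * rho * (degree E i)%:R)^-1 *: d k i.
  rewrite yE; congr (_ *: _).
  have [tK dK dt _] := prox k i; rewrite -[X in projection _ _ X](subrK (t k.+1 i)).
  exact: projection_polar.
have tK k i : K (t k.+1 i) by have [] := prox k i.
have yK k i : polar_cone ip K (y k.+1 i).
  have [_ /polar_coneP dK _ _] := prox k i; apply/polar_coneP => z Kz.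
  rewrite ydE ipZr pmulr_rle0 ?invr_gt0 ?mulr_gt0 //; exact: dK.
have yt0 k i : ip m (y k.+1 i) (t k.+1 i) = 0.
  by have [_ _ dt _] := prox k i; rewrite ydE ipZl dt mulr0.
have stat k i : exists phi : R,
    stationary ip (@f i) (A i) (x k.+1 i) phi (y k.+1 i).
  have [_ _ _ [phi st]] := prox k i; exists phi; rewrite ydE.
  have -> // : (2 * rho * (degree E i)%:R)^-1 = 2 * (4 * rho * (degree E i)%:R)^-1.
  by field; rewrite !gt_eqF.
have stat_all k : exists phi : 'I_N -> R,
    forall i, stationary ip (@f i) (A i) (x k.+1 i) (phi i) (y k.+1 i).
  by have [phi phiP] := choice (stat k); exists phi.
have [phi phiP] := choice stat_all.
pose v k i := b i + t k.+1 i - A i *m x k.+1 i.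
have vE k i : v k i = b i + t k.+1 i - A i *m x k.+1 i by [].
(* The sum is empty at 0, matching [p 0 = 0]. *)
pose w k i := \sum_(l < k) y l i.
have wE k i : w k.+1 i = w k i + y k i by rewrite /w big_ord_recr.
have p_lap k i : p k i = rho *: laplacian E (-1) (w k) i.
  elim: k i => [|k IH] i.
    rewrite p0 /laplacian big1 ?scaler0 // => j _.
    by rewrite /w !big_ord0 scaler0 addr0.
  rewrite pE IH -scalerDr -big_split; congr (_ *: _); apply: eq_bigr => j _ /=.
  by rewrite !wE; apply/colP => a; rewrite !mxE; ring.
have v_eq k i : v k i =
    - (rho *: (laplacian E (-1) (w k.+2) i + laplacian E 1 (y k.+1 - y k) i)).
  have hd : d k i = (2 * rho * (degree E i)%:R) *: y k.+1 i.
    by rewrite ydE scalerA divff ?scale1r // gt_eqF // !mulr_gt0.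
  have hv : v k i = b i + r k.+1 i - d k i.
    by rewrite /v /d; apply/colP => a; rewrite !mxE; ring.
  have hr : r k.+1 i = rho *: laplacian E 1 (y k) i - (b i + p k.+1 i).
    by rewrite rE; congr (_ *: _ - _); apply: eq_bigr => j _; rewrite scale1r.
  have hw : laplacian E (-1) (w k.+2) i =
      laplacian E (-1) (w k.+1) i + laplacian E (-1) (y k.+1) i.
    rewrite -big_split; apply: eq_bigr => j _ /=.
    by rewrite !wE; apply/colP => a; rewrite !mxE; ring.
  (* The degree term becomes both Laplacians of [y k.+1]: one advances [w k.+1] to [w k.+2], the
     other forms the increment of [y]. *)
  rewrite hv hr hd p_lap [2 * rho]mulrC -mulrA -scalerA -laplacian_add_signless.
  by rewrite hw laplacianB; apply/colP => a; rewrite !mxE; ring.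
have [ws wsE] : exists ws : 'I_N -> 'cV[R]_m, forall i,
    vstar E rho ws i = share_dual A b xs i.
  have share0 : \sum_i - (rho^-1 *: share_dual A b xs i) = 0.
    by rewrite sumrN -scaler_sumr (share_dual_sum A b xs i0) scaler0 oppr0.
  have [ws hws] := laplacian_range symE connE ip share0.
  exists ws => i; rewrite /vstar hws scalerN opprK scalerA divff ?scale1r //.
  by rewrite gt_eqF.
have gapE k : monotonicity_gap ip E rho y v ws us k =
    \sum_i ip m (v k i - share_dual A b xs i) (y k.+1 i - us).
  by apply: eq_bigr => i _; rewrite wsE.
have gap_ge0 k : 0 <= monotonicity_gap ip E rho y v ws us k.
  rewrite gapE; apply: sumr_ge0 => i _.
  exact: (gap_term_ge0 coneK tK yK yt0 phiP vE resK usK us_res xs_stat).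
have mono k l i : 0 <= ip m (v k i - v l i) (y k.+1 i - y l.+1 i).
  exact: (dual_monotone tK yK yt0 phiP vE).
have [ybar [vbar [vbar0 y_cvg v_cvg]]] :=
  admm_convergence symE connE degE i0 rho0 wE v_eq gap_ge0 mono.
have gap0 : (fun k => \sum_i ip m (v k i - share_dual A b xs i) (y k.+1 i - us))
    @ \oo --> 0.
  under eq_cvg do rewrite -gapE.
  exact: (gap_cvg0 symE rho0 wE v_eq gap_ge0).
have y1_cvg i : (fun k => y k.+1 i) @ \oo --> ybar.
  by have := y_cvg i; rewrite -[in X in X -> _](cvg_shiftS (fun k => y k i)).
have ybar_res := limit_complementary coneK tK yK yt0 phiP vE resK usK us_res xs_stat
  y1_cvg gap0 i0.
split.
  exists ybar => //; apply: (kkt_dual_maximizer xsP gap _ ybar_res).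
    exact: (limit_polar yK y1_cvg i0).
  exact: (limit_stationary coneK tK yK yt0 phiP vE resK usK us_res xs_stat y1_cvg
    gap0).
move=> xbar x_xbar.
apply: (limit_primal_minimizer closedK convexK coneK tK yt0 phiP vE resK xs_stat
  y1_cvg _ v_cvg vbar0 ybar_res xsP) => [i|]; first by have [_ []] := fP i.
(* Dropping the arbitrary [x 0] preserves cluster points. *)
apply: cvg_cluster x_xbar.
by rewrite -(cvg_shiftS (fun k => \mxcol_i x k i)).
Qed.
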